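(* Let $D\subseteq\mathbb{C}$ be a domain in the upper half-plane, let $\Omega_D=\{x=x_0+\underline{x}\in\mathbb{R}^6:(x_0,|\underline{x}|)\in D\}$, and let $f_\circ(x)=A(x_0,r)+\underline{\omega}B(x_0,r)$ be an axially anti-Cliffordian holomorphic function of order $1$ on $\Omega_D$. Then $A=A(x_0,r)$ and $B=B(x_0,r)$ satisfy the system $$\begin{cases} \partial_{x_0}^3A+\partial_{x_0}\partial_r^2A+\dfrac4r\partial_{x_0}\partial_rA+\partial_r\partial_{x_0}^2B+\partial_r^3B+8\dfrac{\partial_r^2B}{r}+8\dfrac{\partial_rB}{r^2}-8\dfrac{B}{r^3}+\dfrac4r\partial_{x_0}^2B=0,\\[2mm] \partial_{x_0}^3B+\partial_{x_0}\partial_r^2B+4\partial_r\left(\dfrac{\partial_{x_0}B}{r}\right)-\partial_r\partial_{x_0}^2A-\partial_r^3A-4\partial_r\left(\dfrac{\partial_rA}{r}\right)=0. \end{cases}$$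
   Context: $\mathbb{R}_5$ is the real Clifford algebra generated by $e_1,\dots,e_5$ with $e_i^2=-1$, $e_ie_j=-e_je_i$ for $i\ne j$. $\mathbb{R}^6$ is identified with paravectors $x=x_0+\underline{x}$, $\underline{x}=\sum_{i=1}^5x_ie_i=r\underline{\omega}$ with $r=|\underline{x}|>0$ and $\underline{\omega}\in\mathbb{S}=\{\underline{x}:|\underline{x}|=1\}$. A function $f:\Omega_D\to\mathbb{R}_5$ is of axial type if $f(x)=A(x_0,r)+\underline{\omega}B(x_0,r)$ with $A,B$ $\mathbb{R}_5$-valued and independent of $\underline{\omega}$. Operators: $\overline{\mathcal{D}}f=\partial_{x_0}f-\sum_{i=1}^5e_i\partial_{x_i}f$, $\Delta=\sum_{i=0}^5\partial_{x_i}^2$. An axially anti-Cliffordian holomorphic function of order $1$ is a function of axial type, of class $\mathcal{C}^3$, with $\Delta\overline{\mathcal{D}}f=0$ on $\Omega_D$. *)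

(* Defs.v *)
From HB Require Import structures.
From mathcomp Require Import all_boot all_order all_algebra.
From mathcomp Require Import complex.
From mathcomp Require Import all_classical all_reals all_analysis.

Set Implicit Arguments.
Unset Strict Implicit.
Unset Printing Implicit Defensive.

Import Order.TTheory GRing.Theory Num.Theory.
Import numFieldNormedType.Exports.
Local Open Scope classical_set_scope.
Local Open Scope ring_scope.

(* The real Clifford algebra with n anticommuting generators of square -1.
   An element is its vector of coordinates in the basis e_S indexed by the
   subsets S = {i_1 < ... < i_k} of 'I_n, where e_S = e_{i_1} ... e_{i_k}. *)
Definition clifford (R : Type) (n : nat) : Type := 'rV[R]_#|{set 'I_n}|.

Section CliffordAlgebra.
Variables (R : realType) (n : nat).
Implicit Types (S T U : {set 'I_n}).
Local Notation Cl := (clifford R n).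

HB.instance Definition _ := NormedModule.on Cl.

Definition clcoef (x : Cl) S : R := x ord0 (enum_rank S).

Definition clbasis S : Cl := delta_mx ord0 (enum_rank S).

Definition symdiff S T : {set 'I_n} := (S :\: T) :|: (T :\: S).

(* The number of sign changes needed to sort e_S e_T: one for each transposed
   pair i > j, and one for each contraction e_i e_i = -1. *)
Definition inversions S T : nat :=
  \sum_(i in S) \sum_(j in T) (j <= i)%N.

Definition clmul (x y : Cl) : Cl :=
  \sum_S \sum_T
    ((-1) ^+ inversions S T * clcoef x S * clcoef y T) *: clbasis (symdiff S T).

Lemma clcoefE (x : Cl) : x = \sum_S clcoef x S *: clbasis S.
Proof.
rewrite [LHS](row_sum_delta x) (reindex (@enum_rank {set 'I_n})) //=.
by exists enum_val => S _; rewrite ?enum_rankK ?enum_valK.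
Qed.

Lemma clcoef_basis S T : clcoef (clbasis S) T = (S == T)%:R.
Proof. by rewrite /clcoef mxE eqxx /= (inj_eq enum_rank_inj) eq_sym. Qed.

Lemma clcoefP a (x y : Cl) S :
  clcoef (a *: x + y) S = a * clcoef x S + clcoef y S.
Proof. by rewrite /clcoef !mxE. Qed.

Lemma clmul_linearr x a y z :
  clmul x (a *: y + z) = a *: clmul x y + clmul x z.
Proof.
rewrite /clmul scaler_sumr -big_split; apply: eq_bigr => S _ /=.
rewrite scaler_sumr -big_split; apply: eq_bigr => T _ /=.
by rewrite clcoefP mulrDr scalerDl scalerA mulrCA.
Qed.

Lemma clmul_linearl x a y z :
  clmul (a *: y + z) x = a *: clmul y x + clmul z x.
Proof.
rewrite /clmul scaler_sumr -big_split; apply: eq_bigr => S _ /=.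
rewrite scaler_sumr -big_split; apply: eq_bigr => T _ /=.
by rewrite clcoefP mulrDr mulrDl scalerDl scalerA mulrCA !mulrA.
Qed.

Lemma clmulDl : left_distributive clmul +%R.
Proof. by move=> x y z; have := clmul_linearl z 1 x y; rewrite !scale1r. Qed.

Lemma clmulDr : right_distributive clmul +%R.
Proof. by move=> x y z; have := clmul_linearr x 1 y z; rewrite !scale1r. Qed.

Lemma clmul0l x : clmul 0 x = 0.
Proof.
by apply/(addrI (clmul 0 x)); rewrite -clmulDl addr0 addr0.
Qed.

Lemma clmul0r x : clmul x 0 = 0.
Proof.
by apply/(addrI (clmul x 0)); rewrite -clmulDr addr0 addr0.
Qed.

Lemma clmulZl a x y : clmul (a *: x) y = a *: clmul x y.
Proof. by have := clmul_linearl y a x 0; rewrite clmul0l !addr0. Qed.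

Lemma clmulZr a x y : clmul x (a *: y) = a *: clmul x y.
Proof. by have := clmul_linearr x a y 0; rewrite clmul0r !addr0. Qed.

Lemma clmul_basis S T :
  clmul (clbasis S) (clbasis T) =
  (-1) ^+ inversions S T *: clbasis (symdiff S T).
Proof.
rewrite /clmul (bigD1 S) //= [X in _ + X]big1 ?addr0; last first.
  move=> S' neS; apply: big1 => T' _.
  by rewrite clcoef_basis eq_sym (negPf neS) mulr0 mul0r scale0r.
rewrite (bigD1 T) //= [X in _ + X]big1 ?addr0; last first.
  move=> T' neT.
  by rewrite [clcoef (clbasis T) _]clcoef_basis eq_sym (negPf neT) mulr0 scale0r.
by rewrite !clcoef_basis !eqxx !mulr1.
Qed.

Lemma clmul_suml (I : Type) (r : seq I) (F : I -> Cl) x :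
  clmul (\sum_(i <- r) F i) x = \sum_(i <- r) clmul (F i) x.
Proof.
by apply: (big_morph (clmul^~ x)) => [y z|]; rewrite (clmulDl, clmul0l).
Qed.

Lemma clmul_sumr (I : Type) (r : seq I) (F : I -> Cl) x :
  clmul x (\sum_(i <- r) F i) = \sum_(i <- r) clmul x (F i).
Proof.
by apply: (big_morph (clmul x)) => [y z|]; rewrite (clmulDr, clmul0r).
Qed.

Lemma symdiffA : associative symdiff.
Proof.
move=> S T U; apply/setP => i; rewrite !inE.
by case: (i \in S); case: (i \in T); case: (i \in U).
Qed.

Lemma odd_inversionsDl S T U :
  odd (inversions (symdiff S T) U) = odd (inversions S U) (+) odd (inversions T U).
Proof.
rewrite -oddD /inversions ![\sum_(i in _) _]big_mkcond -big_split /=.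
rewrite !(big_morph odd oddD (erefl _)); apply: eq_bigr => i _.
by rewrite !inE; case: (i \in S); case: (i \in T) => //=;
  rewrite ?addn0 ?oddD ?addbb.
Qed.

Lemma odd_inversionsDr S T U :
  odd (inversions U (symdiff S T)) = odd (inversions U S) (+) odd (inversions U T).
Proof.
rewrite -oddD /inversions -big_split /=.
rewrite !(big_morph odd oddD (erefl _)); apply: eq_bigr => j _.
rewrite ![\sum_(i in _) _]big_mkcond -big_split /=.
rewrite !(big_morph odd oddD (erefl _)); apply: eq_bigr => i _.
by rewrite !inE; case: (i \in S); case: (i \in T) => //=;
  rewrite ?addn0 ?oddD ?addbb.
Qed.

Lemma clmulA : associative clmul.
Proof.
have sumA (F G H : {set 'I_n} -> Cl) :
    (forall S T U, clmul (F S) (clmul (G T) (H U)) =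
                   clmul (clmul (F S) (G T)) (H U)) ->
    clmul (\sum_S F S) (clmul (\sum_S G S) (\sum_S H S)) =
    clmul (clmul (\sum_S F S) (\sum_S G S)) (\sum_S H S).
  move=> FGH; transitivity
    (\sum_S \sum_T \sum_U clmul (F S) (clmul (G T) (H U))).
    rewrite clmul_suml; apply: eq_bigr => S _.
    rewrite clmul_suml clmul_sumr; apply: eq_bigr => T _.
    by rewrite clmul_sumr clmul_sumr.
  rewrite (clmul_suml _ F (\sum_S G S)) (clmul_suml _ _ (\sum_S H S)).
  apply: eq_bigr => S _; rewrite (clmul_sumr _ G (F S)).
  rewrite (clmul_suml _ _ (\sum_S H S)); apply: eq_bigr => T _.
  rewrite (clmul_sumr _ H (clmul (F S) (G T))).
  by apply: eq_bigr.
move=> x y z; rewrite (clcoefE x) (clcoefE y) (clcoefE z).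
apply: sumA => S T U; rewrite !(clmulZl, clmulZr).
rewrite !clmul_basis clmulZr clmulZl !clmul_basis !scalerA symdiffA.
congr (_ *: _); rewrite -!mulrA [RHS]mulrCA; congr (_ * _).
rewrite [RHS]mulrCA; congr (_ * (_ * _)); rewrite -!exprD.
rewrite -signr_odd -[RHS]signr_odd !oddD.
by rewrite odd_inversionsDl odd_inversionsDr addbC addbA.
Qed.

Lemma clmul1l : left_id (clbasis finset.set0) clmul.
Proof.
move=> x; rewrite [in RHS](clcoefE x) {1}(clcoefE x) clmul_sumr.
apply: eq_bigr => S _; rewrite clmulZr clmul_basis /inversions big_set0 expr0.
by rewrite scale1r /symdiff finset.set0D finset.setD0 finset.set0U.
Qed.

Lemma clmul1r : right_id (clbasis finset.set0) clmul.
Proof.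
move=> x; rewrite [in RHS](clcoefE x) {1}(clcoefE x) clmul_suml.
apply: eq_bigr => S _; rewrite clmulZl clmul_basis /inversions.
rewrite big1 ?expr0; last by move=> i _; rewrite big_set0.
by rewrite scale1r /symdiff finset.set0D finset.setD0 finset.setU0.
Qed.

Lemma clbasis0_neq0 : clbasis finset.set0 != 0.
Proof.
apply/eqP => /(congr1 (clcoef^~ finset.set0)).
by rewrite clcoef_basis eqxx /clcoef mxE => /eqP; rewrite oner_eq0.
Qed.

HB.instance Definition _ := GRing.Zmodule_isNzRing.Build Cl
  clmulA clmul1l clmul1r clmulDl clmulDr clbasis0_neq0.

Let clscaleAl a (x y : Cl) : a *: (x * y) = a *: x * y.
Proof. by rewrite -clmulZl. Qed.

HB.instance Definition _ := GRing.Lmodule_isLalgebra.Build R Cl clscaleAl.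

Let clscaleAr a (x y : Cl) : a *: (x * y) = x * (a *: y).
Proof. by rewrite -clmulZr. Qed.

HB.instance Definition _ := GRing.Lalgebra_isAlgebra.Build R Cl clscaleAr.

End CliffordAlgebra.

Section Generators.
Variables (R : realType) (n : nat).
Implicit Types (i j : 'I_n) (S : {set 'I_n}).

Definition clgen i : clifford R n := clbasis R [set i].

Lemma clbasisM S T : clbasis R S * clbasis R T =
  (-1) ^+ inversions S T *: clbasis R (symdiff S T).
Proof. exact: clmul_basis. Qed.

Lemma clgen_sqr i : clgen i * clgen i = -1.
Proof.
rewrite clbasisM /inversions !big_set1 leqnn expr1 scaleN1r.
by rewrite /symdiff finset.setDv finset.setU0.
Qed.

Lemma clgen_anticomm i j : i != j -> clgen i * clgen j = - (clgen j * clgen i).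
Proof.
move=> neq_ij; rewrite !clbasisM /inversions !big_set1.
rewrite /symdiff finset.setUC -scaleNr; congr (_ *: _).
by move: neq_ij; rewrite -val_eqE; case: ltngtP => //= _ _;
  rewrite ?expr1 ?expr0 ?opprK.
Qed.

Lemma clbasis_prod S : clbasis R S = \prod_(i <- enum S) clgen i.
Proof.
have sorted_prod (s : seq 'I_n) : sorted ltn (map val s) ->
    \prod_(i <- s) clgen i = clbasis R [set i in s]%SET.
  elim: s => [_|i s IHs /= lt_i_s].
    by rewrite big_nil -[LHS]/(clbasis R finset.set0); congr (clbasis R _).
  have i_lt j : j \in s -> (i < j)%N.
    move=> s_j; apply: (allP (order_path_min ltn_trans lt_i_s)).
    exact: map_f.
  have i'_s : i \notin s by apply/negP => /i_lt; rewrite ltnn.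
  rewrite big_cons IHs ?(path_sorted lt_i_s) // clbasisM /inversions big_set1.
  rewrite big1 => [|j]; last first.
    by rewrite inE => /i_lt; rewrite ltnNge => /negPf->.
  rewrite expr0 scale1r; congr (clbasis R _); apply/setP => j.
  rewrite !inE; case: (eqVneq j i) => [->|_] //=; first by rewrite i'_s.
  by case: (j \in s).
rewrite sorted_prod.
  by congr (clbasis R _); apply/setP => i; rewrite !inE mem_enum.
rewrite /enum_mem.
apply: (subseq_sorted ltn_trans (map_subseq _ (filter_subseq _ _))).
by rewrite -enumT val_enum_ord iota_ltn_sorted.
Qed.

End Generators.

(* A point x of 'rV[R]_n.+1 stands for the paravector x_0 + x_1 e_1 + ... +
   x_n e_n; the generator e_(i + 1) is clgen i for i : 'I_n. *)
Section Paravectors.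
Variables (R : realType) (n : nat).
Local Notation Cl := (clifford R n).
Implicit Types (x : 'rV[R]_n.+1) (f : 'rV[R]_n.+1 -> Cl).

Definition vecpart x : Cl := \sum_(i < n) x ord0 (lift ord0 i) *: clgen R i.

(* The norm of the library on row vectors is the sup norm, hence this one. *)
Definition radius x : R := Num.sqrt (\sum_(i < n) x ord0 (lift ord0 i) ^+ 2).

Definition omega x : Cl := (radius x)^-1 *: vecpart x.

Definition partial (i : 'I_n.+1) f : 'rV[R]_n.+1 -> Cl :=
  fun x => 'D_(delta_mx ord0 i) f x.

Definition conj_dirac f : 'rV[R]_n.+1 -> Cl :=
  fun x => partial ord0 f x - \sum_(i < n) clgen R i * partial (lift ord0 i) f x.

Definition laplacian f : 'rV[R]_n.+1 -> Cl :=
  fun x => \sum_(i < n.+1) partial i (partial i f) x.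

Fixpoint class_C (k : nat) (U : set 'rV[R]_n.+1) f : Prop :=
  (forall x, U x -> {for x, continuous f}) /\
  if k is k'.+1 then
    forall i, (forall x, U x -> derivable f x (delta_mx ord0 i)) /\
              class_C k' U (partial i f)
  else True.

(* R[i]^o is the field of complex numbers with the topology of its modulus; a
   point (x_0, r) of the half-plane is the complex number x_0 +i* r. *)
Definition axial_domain (D : set R[i]^o) : set 'rV[R]_n.+1 :=
  [set x : 'rV[R]_n.+1 | D (x ord0 ord0 +i* radius x)%C].

Definition axial_decomposition (D : set R[i]^o) f (A B : R -> R -> Cl) : Prop :=
  forall x, axial_domain D x ->
    f x = A (x ord0 ord0) (radius x) + omega x * B (x ord0 ord0) (radius x).

Definition axially_antiCliffordian_order1 (D : set R[i]^o) f : Prop :=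
  [/\ exists A B, axial_decomposition D f A B,
      class_C 3 (axial_domain D) f &
      forall x, axial_domain D x -> laplacian (conj_dirac f) x = 0].

End Paravectors.

Definition upper_half_plane_domain (R : realType) (D : set R[i]^o) : Prop :=
  [/\ open D, connected D, D !=set0 & forall z, D z -> 0 < complex.Im z].

Section HalfPlanePartials.
Variables (R : realType) (V : normedModType R).

Definition d_x0 (A : R -> R -> V) : R -> R -> V :=
  fun x0 r => derive1 (fun t => A t r) x0.

Definition d_r (A : R -> R -> V) : R -> R -> V :=
  fun x0 r => derive1 (fun t => A x0 t) r.

End HalfPlanePartials.

(* Main.v *)
Require Import Defs.
From mathcomp Require Import all_boot all_order all_algebra.
From mathcomp Require Import ring lra.
From mathcomp Require Import complex.
From mathcomp Require Import all_classical all_reals all_analysis.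
Import Order.TTheory GRing.Theory Num.Theory.
Import numFieldNormedType.Exports.
Local Open Scope classical_set_scope.
Local Open Scope ring_scope.
Set Implicit Arguments.
Unset Strict Implicit.
Unset Printing Implicit Defensive.

(** The conjugate Dirac operator and the Laplacian preserve functions of axial
    type, so that the equation for f is a pair of equations for its two profiles.

    It is convenient to write axial functions as P(x_0, r) + x' H(x_0, r) with
    x' the vector part of x, which is linear in x and satisfies x' x' = - r^2;
    the H of f is B / r.  Along a coordinate line of the vector part x_0 is
    constant and d r / d x_i = x_i / r, so the partial derivative of such a
    function is x_i (P_r / r + x' H_r / r) + e_i H: again an axial function up
    to the factor x_i.  Summing over i gives, in n vector dimensions,
<<
      conj_dirac : P, H  |->  P_0 + n H + r H_r,  H_0 - P_r / r
      laplacian  : P, H  |->  P_00 + P_rr + (n - 1) / r P_r,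
                              H_00 + H_rr + (n + 1) / r H_r
>>
    (conj_dirac_axial and laplacian_axial).  For n = 5, P = A and H = B / r, the
    first line gives A_0 + B_r + 4 B / r and (B_0 - A_r) / r
    (conj_dirac_decomposition), and the second line applied to these gives the
    two left-hand sides of the system, the second one divided by r
    (laplacian_dirac_scalar and laplacian_dirac_vector).  An axial function that
    vanishes at the two opposite points x_0 + r e_j and x_0 - r e_j has both
    profiles equal to 0 at (x_0, r) (axial_eq0), and this splits the equation.

    Two points of regularity remain, because only f is assumed to be of class
    C^3.  First, A and B are combinations of f at x_0 + r e_j and x_0 - r e_j
    (axial_decomposition_slices), so their iterated derivatives are combinations
    of iterated partial derivatives of f (smooth_slice).  Second, the system
    lists the mixed derivatives in an order that differs from the one produced
    by the computation; they are exchanged by Schwarz's theorem for f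
    (partialC), proved coordinatewise from the mean value theorem. *)

(** * Directional derivatives *)

Section DirectionalDerivatives.
Variables (R : realType) (V : normedModType R).
Implicit Types (x v : V).

(** Reduces directional derivatives to derivatives in one real variable; the
    base point s lets f be differentiated at any point of the line. *)
Lemma is_derive_lineP (W : normedModType R) (f : V -> W) x v (s : R) (df : W) :
  is_derive (s *: v + x) v f df <-> is_derive s 1 (fun h => f (h *: v + x)) df.
Proof.
have E : (fun h => h^-1 *: ((f \o shift (s *: v + x)) (h *: v) -
                            f (s *: v + x))) =
    (fun h => h^-1 *: (((fun k => f (k *: v + x)) \o shift s) (h *: 1) -
                       f (s *: v + x))).
  by apply/funext => h /=; rewrite [_%:A]mulr1 scalerDl addrA.
by split=> -[]; rewrite /derivable /derive; [rewrite E|rewrite -E] => d1 d2;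
  split; rewrite /derivable /derive; rewrite ?E // -E.
Qed.

Lemma is_derive_line0P (W : normedModType R) (f : V -> W) x v (df : W) :
  is_derive x v f df <-> is_derive (0 : R) 1 (fun h => f (h *: v + x)) df.
Proof. by rewrite -is_derive_lineP scale0r add0r. Qed.

Lemma is_derive_rowP m (F : V -> 'rV[R]_m) x v (dF : 'rV[R]_m) :
  is_derive x v F dF <->
  forall k, is_derive x v (fun y => F y ord0 k) (dF ord0 k).
Proof.
split=> [[dFx <-] k|dFx].
  split; first exact: (derivable_mxP F x v).1 dFx ord0 k.
  by rewrite derive_mx // mxE.
have FD : derivable F x v.
  by apply/derivable_mxP => i j; rewrite ord1; have [] := dFx j.
split=> //; rewrite derive_mx //; apply/rowP => k.
by rewrite mxE; have [] := dFx k.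
Qed.

Lemma is_derive_chain (W : normedModType R) (g : V -> R) (f : R -> W) x v dg df :
  is_derive x v g dg -> is_derive (g x) 1 f df ->
  is_derive x v (fun y => f (g y)) (dg *: df).
Proof.
move=> /is_derive_line0P [/derivable1_diffP dgx gE] [/derivable1_diffP dfx fE].
apply/is_derive_line0P.
pose G h := g (h *: v + x); have G0 : G 0 = g x by rewrite /G scale0r add0r.
have dc : differentiable (f \o G) 0.
  by apply: differentiable_comp; rewrite // G0.
split; first exact/derivable1_diffP.
rewrite (_ : (fun h => _) = f \o G) // deriveE // diff_comp // ?G0 //=.
by rewrite -[X in 'd f _ X]deriveE // gE diff1E // derive1E fE.
Qed.

Lemma is_derive_scale m (s : V -> R) (F : V -> 'rV[R]_m) x v ds dF :
  is_derive x v s ds -> is_derive x v F dF ->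
  is_derive x v (fun y => s y *: F y) (ds *: F x + s x *: dF).
Proof.
move=> sD /is_derive_rowP FD; apply/is_derive_rowP => k.
rewrite (_ : (fun y => _) = s * (fun y => F y ord0 k)); last first.
  by apply/funext => y; rewrite mxE.
apply: (is_derive_eq (is_deriveM sD (FD k))).
by rewrite !mxE addrC; congr (_ + _); rewrite mulrC.
Qed.

Lemma is_derive_bigsum (W : normedModType R) (I : Type) (r : seq I)
    (F : I -> V -> W) x v (dF : I -> W) :
  (forall i, is_derive x v (F i) (dF i)) ->
  is_derive x v (fun y => \sum_(i <- r) F i y) (\sum_(i <- r) dF i).
Proof.
move=> FD; elim: r => [|i r IHr].
  rewrite big_nil (_ : (fun y => _) = cst 0); first exact: is_derive_cst.
  by apply/funext => y; rewrite big_nil.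
rewrite big_cons (_ : (fun y => _) = F i + (fun y => \sum_(i <- r) F i y)).
  exact: (is_deriveD (FD i) IHr).
by apply/funext => y; rewrite big_cons.
Qed.

(** The product of the Clifford algebra is a bilinear polynomial in the
    coordinates, so the Leibniz rule follows from the one for real functions. *)
Lemma is_derive_clmul n (F G : V -> clifford R n) x v dF dG :
  is_derive x v F dF -> is_derive x v G dG ->
  is_derive x v (fun y => F y * G y) (dF * G x + F x * dG).
Proof.
move=> /is_derive_rowP FD /is_derive_rowP GD.
have clmulE (a b : clifford R n) : a * b =
    \sum_S \sum_T (clcoef a S * clcoef b T) *:
      ((-1) ^+ inversions S T *: clbasis R (symdiff S T)).
  rewrite -[a * b]/(clmul a b) /clmul.
  apply: eq_bigr => S _; apply: eq_bigr => T _.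
  by rewrite scalerA -mulrA; congr (_ *: _); exact: mulrC.
under eq_fun do rewrite clmulE.
have -> : dF * G x + F x * dG = \sum_S \sum_T
   (clcoef dF S * clcoef (G x) T + clcoef (F x) S * clcoef dG T) *:
    ((-1) ^+ inversions S T *: clbasis R (symdiff S T)).
  rewrite !clmulE -big_split; apply: eq_bigr => S _ /=.
  by rewrite -big_split; apply: eq_bigr => T _ /=; rewrite scalerDl.
apply: is_derive_bigsum => S; apply: is_derive_bigsum => T.
set c := _ *: clbasis _ _.
have sD : is_derive x v (fun y => clcoef (F y) S * clcoef (G y) T)
   (clcoef dF S * clcoef (G x) T + clcoef (F x) S * clcoef dG T).
  apply: (is_derive_eq (is_deriveM (FD (enum_rank S)) (GD (enum_rank T)))).
  rewrite addrC; congr (_ + _); exact: mulrC.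
apply: (is_derive_eq (is_derive_scale sD (is_derive_cst c x v))).
by rewrite scaler0 addr0.
Qed.

End DirectionalDerivatives.

(** * Symmetry of mixed partial derivatives *)

Section MixedPartials.
Variable R : realType.

(** Two applications of the mean value theorem: to s |-> F s h - F s 0, then to
    t |-> F1 s t at the point s so obtained. *)
Lemma second_difference (F F1 F12 : R -> R -> R) (h : R) : 0 < h ->
  (forall s t : R, 0 <= s <= h -> 0 <= t <= h -> is_derive s 1 (F^~ t) (F1 s t)) ->
  (forall s t : R, 0 <= s <= h -> 0 <= t <= h -> is_derive t 1 (F1 s) (F12 s t)) ->
  exists s t, [/\ 0 < s < h, 0 < t < h &
    F h h - F 0 h - (F h 0 - F 0 0) = F12 s t * h * h].
Proof.
move=> h0 DF DF1.
have MVT0 (g dg : R -> R) : (forall s : R, 0 <= s <= h -> is_derive s 1 g (dg s)) ->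
    exists2 s : R, 0 < s < h & g h - g 0 = dg s * h.
  move=> dgP; have [||s] := @MVT R g dg 0 h h0.
  - by move=> s; rewrite in_itv /= => /andP[/ltW s0 /ltW sh]; apply: dgP; rewrite s0.
  - apply: derivable_within_continuous => s; rewrite in_itv /= => sh.
    by have [] := dgP s sh.
  - by rewrite in_itv subr0; exists s.
have hh : 0 <= h <= h by rewrite lexx ltW.
have h00 : 0 <= (0 : R) <= h by rewrite lexx ltW.
have [s s0h Es] : exists2 s : R, 0 < s < h &
    (F h h - F h 0) - (F 0 h - F 0 0) = (F1 s h - F1 s 0) * h.
  apply: (MVT0 (fun s => F s h - F s 0)) => s sh.
  exact: (is_deriveB (DF s h sh hh) (DF s 0 sh h00)).
have sh : 0 <= s <= h by case/andP: s0h => /ltW -> /ltW ->.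
have [t t0h Et] := MVT0 (F1 s) (F12 s) (fun t => DF1 s t sh).
by exists s, t; split => //; rewrite -Et -Es; ring.
Qed.

(** The second difference is symmetric in the two variables, so on every small
    square F12 and F21 take a common value up to the choice of the points;
    continuity at the origin does the rest. *)
Lemma mixed_derivatives_eq (F F1 F2 F12 F21 : R -> R -> R) (e : R) : 0 < e ->
  (forall s t : R, `|s| < e -> `|t| < e ->
    [/\ is_derive s 1 (F^~ t) (F1 s t), is_derive t 1 (F s) (F2 s t),
        is_derive t 1 (F1 s) (F12 s t) & is_derive s 1 (F2^~ t) (F21 s t)]) ->
  (forall k : R, 0 < k -> exists2 d : R, 0 < d & forall s t : R, `|s| < d -> `|t| < d ->
    `|F12 0 0 - F12 s t| < k /\ `|F21 0 0 - F21 s t| < k) ->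
  F12 0 0 = F21 0 0.
Proof.
move=> e0 DF cont; apply/eqP; rewrite -subr_eq0 -normr_le0.
apply/ler_addgt0Pr => k k0; rewrite add0r.
have [|d d0 dk] := cont (k / 2); first exact: divr_gt0.
pose h := Num.min e d / 2.
have m0 : 0 < Num.min e d by rewrite lt_min e0.
have h0 : 0 < h by rewrite divr_gt0.
have hm : h < Num.min e d by rewrite /h ltr_pdivrMr // ltr_pMr // ltr1n.
have [he hd] : h < e /\ h < d by move: hm; rewrite lt_min => /andP.
have in_e s : 0 <= s <= h -> `|s| < e.
  by case/andP=> s0 sh; rewrite ger0_norm //; apply: le_lt_trans he.
have in_d s : 0 < s < h -> `|s| < d.
  by case/andP=> s0 sh; rewrite gtr0_norm //; apply: lt_trans hd.
have [||s [t [sh th E1]]] := @second_difference F F1 F12 h h0.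
- by move=> s t /in_e se /in_e te; have [] := DF s t se te.
- by move=> s t /in_e se /in_e te; have [] := DF s t se te.
have [||t' [s' [th' sh' E2]]] :=
  @second_difference (fun t s => F s t) (fun t s => F2 s t) (fun t s => F21 s t) h h0.
- by move=> t' s' /in_e te /in_e se; have [] := DF s' t' se te.
- by move=> t' s' /in_e te /in_e se; have [] := DF s' t' se te.
have E : F12 s t = F21 s' t'.
  have hn0 : h != 0 by rewrite gt_eqF.
  apply: (mulIf hn0); apply: (mulIf hn0); rewrite -E1 -E2; ring.
have [k1 _] := dk s t (in_d s sh) (in_d t th).
have [_ k2] := dk s' t' (in_d s' sh') (in_d t' th').
have -> : F12 0 0 - F21 0 0 = (F12 0 0 - F12 s t) - (F21 0 0 - F21 s' t').
  by rewrite E; ring.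
rewrite (le_trans (ler_normB _ _)) // (splitr k); apply: lerD; exact: ltW.
Qed.

End MixedPartials.

Section ClassC.
Variables (R : realType) (n : nat) (U : set 'rV[R]_n.+1).
Implicit Types f : 'rV[R]_n.+1 -> clifford R n.

Lemma class_C_continuous k f x : class_C k U f -> U x -> {for x, continuous f}.
Proof. by case: k => [|k] [fc _] Ux; apply: fc. Qed.

Lemma class_C_derivable k f i x : class_C k.+1 U f -> U x ->
  derivable f x (delta_mx ord0 i).
Proof. by case=> _ /(_ i)[fd _]; apply: fd. Qed.

Lemma class_C_partial k f i : class_C k.+1 U f -> class_C k U (partial i f).
Proof. by case=> _ /(_ i)[]. Qed.

(** Schwarz's theorem, obtained coordinate by coordinate on the plane through x
    spanned by the two directions. *)
Lemma partialC k f i j x : open U -> class_C k.+2 U f -> U x ->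
  partial i (partial j f) x = partial j (partial i f) x.
Proof.
move=> Uo fC Ux; apply/rowP => c.
pose ei : 'rV[R]_n.+1 := delta_mx ord0 i.
pose ej : 'rV[R]_n.+1 := delta_mx ord0 j.
pose p (s t : R) := s *: ei + (t *: ej + x).
have pE s t : p s t = t *: ej + (s *: ei + x) by rewrite /p addrCA.
have near_p (P : set 'rV[R]_n.+1) : (\forall y \near x, P y) ->
    exists2 e : R, 0 < e & forall s t : R, `|s| < e -> `|t| < e -> P (p s t).
  move=> /nbhs_normP [e /= e0 eP]; exists (e / 2); first exact: divr_gt0.
  move=> s t se te; apply: eP => /=.
  have norm1 (a : 'I_n.+1) : `|delta_mx ord0 a : 'rV[R]_n.+1| <= 1.
    rewrite [leLHS]mx_normrE; apply: bigmax_le => //= [[a1 a2]] _ /=.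
    by rewrite !mxE; case: (_ && _); rewrite ?normr1 ?normr0.
  rewrite /p addrA opprD addrCA subrr addr0 normrN.
  apply: (le_lt_trans (ler_normD _ _)); rewrite !normrZ (splitr e).
  apply: ltrD; [apply: le_lt_trans se|apply: le_lt_trans te].
    by rewrite ler_piMr // norm1.
  by rewrite ler_piMr // norm1.
have [e e0 eU] := near_p U (open_nbhs_nbhs (conj Uo Ux)).
have line (g : 'rV[R]_n.+1 -> clifford R n) a y (s : R) :
    derivable g (s *: delta_mx ord0 a + y) (delta_mx ord0 a) ->
    is_derive s 1 (fun h => g (h *: delta_mx ord0 a + y) ord0 c)
      (partial a g (s *: delta_mx ord0 a + y) ord0 c).
  move=> /derivableP /is_derive_lineP /is_derive_rowP; exact.
have key : partial j (partial i f) (p 0 0) ord0 c =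
           partial i (partial j f) (p 0 0) ord0 c; last first.
  by have p0 : p 0 0 = x; [rewrite /p !scale0r !add0r|rewrite p0 in key; exact: esym].
apply: (@mixed_derivatives_eq R (fun s t => f (p s t) ord0 c)
  (fun s t => partial i f (p s t) ord0 c) (fun s t => partial j f (p s t) ord0 c)
  (fun s t => partial j (partial i f) (p s t) ord0 c)
  (fun s t => partial i (partial j f) (p s t) ord0 c) e e0).
  move=> s t se te; have Up := eU s t se te.
  have dC a := class_C_derivable (class_C_partial a fC).
  split; first by apply: line; apply: (class_C_derivable fC).
  - rewrite (_ : (fun t0 => _) = fun t0 => f (t0 *: ej + (s *: ei + x)) ord0 c);
      last by apply/funext => t0; rewrite pE.
    rewrite pE; apply: line.
    by rewrite -pE; apply: (class_C_derivable fC).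
  - rewrite (_ : (fun t0 => _) =
      fun t0 => partial i f (t0 *: ej + (s *: ei + x)) ord0 c);
      last by apply/funext => t0; rewrite pE.
    rewrite pE; apply: line.
    by rewrite -pE; apply: dC.
  - by apply: line; apply: dC.
move=> k0 k00.
have cC a b : \forall y \near x, `|partial a (partial b f) x ord0 c -
    partial a (partial b f) y ord0 c| < k0.
  have := class_C_continuous (class_C_partial a (class_C_partial b fC)) Ux.
  move=> pc; have := continuous_comp pc (@coord_continuous R 1 _ ord0 c _).
  move=> /cvgrPdist_lt /(_ k0 k00); exact.
have [d1 d10 d1P] := near_p _ (cC j i).
have [d2 d20 d2P] := near_p _ (cC i j).
exists (Num.min d1 d2); first by rewrite lt_min d10.
move=> s t; rewrite !lt_min => /andP[s1 s2] /andP[t1 t2].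
have p0 : p 0 0 = x by rewrite /p !scale0r !add0r.
by rewrite p0; split; [apply: d1P|apply: d2P].
Qed.

End ClassC.

(** * Functions on the half-plane *)

Section ComplexTopology.
Variable R : realType.

Lemma complex_continuous (T : topologicalType) (a b : T -> R) (x : T) :
  {for x, continuous a} -> {for x, continuous b} ->
  {for x, continuous (fun y => (a y +i* b y)%C : R[i]^o)}.
Proof.
move=> ca cb; apply/cvgrPdist_lt => -[e e'].
rewrite ltcE /= => /andP[/eqP -> e0].
have e20 : 0 < e / 2 by rewrite divr_gt0.
move/cvgrPdist_lt: ca => /(_ _ e20) ca; move/cvgrPdist_lt: cb => /(_ _ e20) cb.
near=> y.
have ya : `|a x - a y| < e / 2 by near: y.
have yb : `|b x - b y| < e / 2 by near: y.
have -> : (a x +i* b x - (a y +i* b y) = (a x - a y)%:C + (0 +i* (b x - b y)))%C.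
  by apply/eqP; rewrite eq_complex /= addr0 add0r !eqxx.
apply: le_lt_trans (ler_normD _ _) _; rewrite !normc_def /=.
rewrite !expr0n /= addr0 add0r !sqrtr_sqr -rmorphD ltcR.
by rewrite (splitr e) ltrD.
Unshelve. all: by end_near. Qed.

End ComplexTopology.

Section HalfPlaneFunctions.
Variables (R : realType) (n : nat) (D : set R[i]^o).
Hypotheses (Do : open D) (Dpos : forall z, D z -> 0 < complex.Im z).
Local Notation Cl := (clifford R n).
Implicit Types (F G : R -> R -> Cl) (u v : R).

Definition eq_on F G := forall u v, D (u +i* v)%C -> F u v = G u v.

(** Relational forms of d_x0 and d_r: a derivative given by a formula is
    composed through sums and weights without rewriting under d_x0 or d_r. *)
Definition is_d_x0 F F' := forall u v, D (u +i* v)%C ->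
  is_derive u 1 (F^~ v) (F' u v).

Definition is_d_r F F' := forall u v, D (u +i* v)%C ->
  is_derive v 1 (F u) (F' u v).

Definition derivable_on F := is_d_x0 F (d_x0 F) /\ is_d_r F (d_r F).

Definition plus F G u v : Cl := F u v + G u v.

Definition weight c m F u v : Cl := (c / v ^+ m) *: F u v.

(** All words of at most k letters d_x0, d_r exist on D and only depend on the
    numbers of the letters.  Demanding the exchange of derivatives instead of
    continuity gives a class that is closed under sums and weights by pure
    calculation. *)
Fixpoint smooth_on k F : Prop := if k is k'.+1 then
    [/\ derivable_on F, (0 < k')%N -> eq_on (d_x0 (d_r F)) (d_r (d_x0 F)),
        smooth_on k' (d_x0 F) & smooth_on k' (d_r F)]
  else True.

Lemma near_x0 u v : D (u +i* v)%C -> \forall t \near u, D (t +i* v)%C.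
Proof.
move=> Duv; have := @complex_continuous R R id (cst v) u.
by apply; [exact: cvg_id|exact: cvg_cst|exact: open_nbhs_nbhs].
Qed.

Lemma near_r u v : D (u +i* v)%C -> \forall t \near v, D (u +i* t)%C.
Proof.
move=> Duv; have := @complex_continuous R R (cst u) id v.
by apply; [exact: cvg_cst|exact: cvg_id|exact: open_nbhs_nbhs].
Qed.

Lemma halfplane_neq0 u v : D (u +i* v)%C -> v != 0.
Proof. by move=> /Dpos /=; exact: lt0r_neq0. Qed.

Lemma is_d_x0_eq F F' : is_d_x0 F F' -> eq_on (d_x0 F) F'.
Proof. by move=> FF' u v /FF'; rewrite /d_x0 derive1E => -[]. Qed.

Lemma is_d_r_eq F F' : is_d_r F F' -> eq_on (d_r F) F'.
Proof. by move=> FF' u v /FF'; rewrite /d_r derive1E => -[]. Qed.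

Lemma derivable_onI F F0 F1 : is_d_x0 F F0 -> is_d_r F F1 -> derivable_on F.
Proof.
move=> Fx Fr; split=> u v Duv; first by rewrite (is_d_x0_eq Fx Duv); apply: Fx.
by rewrite (is_d_r_eq Fr Duv); apply: Fr.
Qed.

Lemma eq_d_x0 F G : eq_on F G -> eq_on (d_x0 F) (d_x0 G).
Proof.
move=> FG u v Duv; rewrite /d_x0 !derive1E; apply: near_eq_derive.
by apply: filterS (near_x0 Duv) => t; exact: FG.
Qed.

Lemma eq_d_r F G : eq_on F G -> eq_on (d_r F) (d_r G).
Proof.
move=> FG u v Duv; rewrite /d_r !derive1E; apply: near_eq_derive.
by apply: filterS (near_r Duv) => t; exact: FG.
Qed.

Lemma eq_derivable F G : eq_on F G -> derivable_on F -> derivable_on G.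
Proof.
move=> FG [Fx Fr]; apply: (@derivable_onI _ (d_x0 F) (d_r F)) => u v Duv.
  apply: near_eq_is_derive (Fx u v Duv).
  by apply: filterS (near_x0 Duv) => t; exact: FG.
apply: near_eq_is_derive (Fr u v Duv).
by apply: filterS (near_r Duv) => t; exact: FG.
Qed.

Lemma eq_smooth k F G : eq_on F G -> smooth_on k F -> smooth_on k G.
Proof.
elim: k F G => [|k IHk] F G FG; first by [].
move=> [dF FC Fx Fr]; split.
- exact: eq_derivable dF.
- move=> k0 u v Duv; rewrite -[LHS](eq_d_x0 (eq_d_r FG) Duv).
  rewrite -[RHS](eq_d_r (eq_d_x0 FG) Duv).
  exact: FC.
- by apply: IHk Fx; apply: eq_d_x0.
- by apply: IHk Fr; apply: eq_d_r.
Qed.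

Lemma smooth_le k l F : (k <= l)%N -> smooth_on l F -> smooth_on k F.
Proof.
elim: k l F => [//|k IHk] [//|l] F kl [dF FC Fx Fr]; split.
- exact: dF.
- by move=> k0; apply: FC; apply: leq_trans k0 kl.
- exact: IHk Fx.
- exact: IHk Fr.
Qed.

Lemma smooth_derivable k F : smooth_on k F -> (0 < k)%N -> derivable_on F.
Proof. by case: k => [|k] /= sF k0; [case: (notF k0)|case: sF]. Qed.

Lemma is_d_x0_plus F F' G G' :
  is_d_x0 F F' -> is_d_x0 G G' -> is_d_x0 (plus F G) (plus F' G').
Proof. by move=> FF' GG' u v Duv; apply: is_deriveD; [apply: FF'|apply: GG']. Qed.

Lemma is_d_r_plus F F' G G' :
  is_d_r F F' -> is_d_r G G' -> is_d_r (plus F G) (plus F' G').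
Proof. by move=> FF' GG' u v Duv; apply: is_deriveD; [apply: FF'|apply: GG']. Qed.

Lemma is_d_x0_weight c m F F' :
  is_d_x0 F F' -> is_d_x0 (weight c m F) (weight c m F').
Proof. by move=> FF' u v Duv; apply: is_deriveZ; apply: FF'. Qed.

Lemma is_derive_inv_power c m v : v != 0 ->
  is_derive v 1 (fun t : R => c / t ^+ m) ((- c * m%:R) / v ^+ m.+1).
Proof.
move=> v0; have vm0 : v ^+ m != 0 by rewrite expf_neq0.
have [dX dXE] : is_derive v 1 (fun t : R => t ^+ m) (m%:R * v ^+ m.-1).
  split; first exact: exprn_derivable.
  by rewrite exp_derive [_ *: 1]mulr1.
have dV : is_derive v 1 (fun t : R => (t ^+ m)^-1)
    (- (v ^+ m) ^- 2 * (m%:R * v ^+ m.-1)).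
  split; first exact: (@derivableV R R (fun t => t ^+ m) v 1 vm0 dX).
  exact: (etrans (@deriveV R R (fun t => t ^+ m) v 1 vm0 dX)
                (congr1 (fun d => _ * d) dXE)).
apply: (is_derive_eq (is_deriveM (is_derive_cst c v 1) dV)).
rewrite scaler0 addr0 /= -![_ *: _]/(_ * _).
case: m vm0 {dX dV dXE} => [|m] vm0; first by rewrite !(mulr0, mul0r).
have w0 : v ^+ m != 0 by rewrite expf_neq0.
by rewrite /= !exprS expr0; field; rewrite v0 w0.
Qed.

Lemma is_d_r_weight c m F F' : is_d_r F F' ->
  is_d_r (weight c m F) (plus (weight (- c * m%:R) m.+1 F) (weight c m F')).
Proof.
move=> FF' u v Duv; apply: is_derive_scale (FF' u v Duv).
exact/is_derive_inv_power/(halfplane_neq0 Duv).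
Qed.

Lemma smooth_plus k F G : smooth_on k F -> smooth_on k G -> smooth_on k (plus F G).
Proof.
elim: k F G => [|k IHk] F G; first by [].
move=> [[Fx Fr] FC sFx sFr] [[Gx Gr] GC sGx sGr].
have dx := is_d_x0_plus Fx Gx; have dr := is_d_r_plus Fr Gr.
split; first exact: derivable_onI dx dr.
- move=> k0 u v Duv.
  have [[_ Fxr] [Frx _]] := (smooth_derivable sFx k0, smooth_derivable sFr k0).
  have [[_ Gxr] [Grx _]] := (smooth_derivable sGx k0, smooth_derivable sGr k0).
  rewrite [LHS](eq_d_x0 (is_d_r_eq dr) Duv) [RHS](eq_d_r (is_d_x0_eq dx) Duv).
  rewrite [LHS](is_d_x0_eq (is_d_x0_plus Frx Grx) Duv).
  rewrite [RHS](is_d_r_eq (is_d_r_plus Fxr Gxr) Duv).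
  exact: (congr2 +%R (FC k0 u v Duv) (GC k0 u v Duv)).
- by apply: eq_smooth (IHk _ _ sFx sGx) => u v Duv; exact: esym (is_d_x0_eq dx Duv).
- by apply: eq_smooth (IHk _ _ sFr sGr) => u v Duv; exact: esym (is_d_r_eq dr Duv).
Qed.

(** The radial derivative of a weight produces the weight of next order, which
    is why the induction is over all c and m at once. *)
Lemma smooth_weight k c m F : smooth_on k F -> smooth_on k (weight c m F).
Proof.
elim: k c m F => [|k IHk] c m F; first by [].
move=> [[Fx Fr] FC sFx sFr].
have dx := is_d_x0_weight c m Fx; have dr := is_d_r_weight c m Fr.
split; first exact: derivable_onI dx dr.
- move=> k0 u v Duv.
  have [[_ Fxr] [Frx _]] := (smooth_derivable sFx k0, smooth_derivable sFr k0).
  rewrite [LHS](eq_d_x0 (is_d_r_eq dr) Duv) [RHS](eq_d_r (is_d_x0_eq dx) Duv).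
  rewrite [LHS](is_d_x0_eq
    (is_d_x0_plus (is_d_x0_weight _ _ Fx) (is_d_x0_weight _ _ Frx)) Duv).
  rewrite [RHS](is_d_r_eq (is_d_r_weight _ _ Fxr) Duv).
  exact: (congr1 (fun w => _ + _ *: w) (FC k0 u v Duv)).
- by apply: eq_smooth (IHk c m _ sFx) => u v Duv; exact: esym (is_d_x0_eq dx Duv).
- have sF : smooth_on k F by apply: (smooth_le (leqnSn k)); split; first split.
  apply: eq_smooth (smooth_plus (IHk (- c * m%:R) m.+1 _ sF) (IHk c m _ sFr)).
  by move=> u v Duv; exact: esym (is_d_r_eq dr Duv).
Qed.

Lemma smooth_d_x0 k F : smooth_on k.+1 F -> smooth_on k (d_x0 F).
Proof. by case=> _ _ sFx _; exact: sFx. Qed.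

Lemma smooth_d_r k F : smooth_on k.+1 F -> smooth_on k (d_r F).
Proof. by case=> _ _ _ sFr; exact: sFr. Qed.

Lemma smoothC k F : smooth_on k.+2 F -> eq_on (d_x0 (d_r F)) (d_r (d_x0 F)).
Proof. by case=> _ FC _ _; apply: FC. Qed.

End HalfPlaneFunctions.

(** * Paravectors and their vector part *)

(* Unqualified, radius would be the radius of a ball. *)
Local Notation radius := Defs.radius.

Section ParavectorGeometry.
Variables (R : realType) (n : nat).
Local Notation Cl := (clifford R n).
Implicit Types (x : 'rV[R]_n.+1) (i j : 'I_n) (u v : R).
Local Notation e0 := (delta_mx ord0 ord0 : 'rV[R]_n.+1).
Local Notation e_ i := (delta_mx ord0 (lift ord0 i) : 'rV[R]_n.+1).

Lemma radius_sqr x : radius x ^+ 2 = \sum_(i < n) x ord0 (lift ord0 i) ^+ 2.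
Proof. by rewrite sqr_sqrtr //; apply: sumr_ge0 => i _; apply: sqr_ge0. Qed.

(** Adding the double sum to its transpose cancels the off-diagonal terms by
    anticommutation and doubles the diagonal ones. *)
Lemma vecpart_sqr x : vecpart x * vecpart x = - (radius x ^+ 2) *: 1.
Proof.
pose a i j : Cl := (x ord0 (lift ord0 i) * x ord0 (lift ord0 j)) *:
  (clgen R i * clgen R j).
have sqE : vecpart x * vecpart x = \sum_i \sum_j a i j.
  rewrite mulr_suml; apply: eq_bigr => i _; rewrite mulr_sumr.
  by apply: eq_bigr => j _; rewrite -scalerAl -scalerAr scalerA.
have aC i j : a i j + a j i = (i == j)%:R *: (a i i *+ 2).
  have [<-|ij] := eqVneq i j; first by rewrite scale1r.
  by rewrite scale0r /a clgen_anticomm // [X in X *: - _]mulrC scalerN addNr.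
have two0 : (2 : R) != 0 by rewrite pnatr_eq0.
apply: (scalerI two0); rewrite scaler_nat mulr2n {1}sqE exchange_big sqE.
rewrite -big_split /= scaleNr scalerN radius_sqr !scaler_suml scaler_sumr -sumrN.
apply: eq_bigr => i _; rewrite -big_split /= (bigD1 i) //= aC eqxx scale1r.
rewrite big1 ?addr0 => [|j ji]; last by rewrite aC (negPf ji) scale0r.
by rewrite /a clgen_sqr -expr2 scalerN scaler_nat mulNrn.
Qed.

Lemma is_derive_coord m (x v : 'rV[R]_m) k :
  is_derive x v (fun y => y ord0 k) (v ord0 k).
Proof. exact: (is_derive_rowP id x v v).1 (is_derive_id x v) k. Qed.

(** The differential of r^2 in the direction e_i is 2 x_i; divide by 2 r. *)
Lemma is_derive_radius x i : 0 < radius x ->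
  is_derive x (e_ i) (@radius R n) (x ord0 (lift ord0 i) / radius x).
Proof.
move=> r0; have q0 : 0 < \sum_(i < n) x ord0 (lift ord0 i) ^+ 2.
  by rewrite -radius_sqr exprn_gt0.
have qD : is_derive x (e_ i)
    (fun y : 'rV[R]_n.+1 => \sum_(j < n) y ord0 (lift ord0 j) ^+ 2)
    (\sum_(j < n) 2 * x ord0 (lift ord0 j) * (i == j)%:R).
  apply: is_derive_bigsum => j.
  have D := is_derive_coord x (e_ i) (lift ord0 j).
  apply: (is_derive_eq (is_deriveM D D)).
  rewrite mxE eqxx (inj_eq lift_inj) [j == i]eq_sym /=.
  by rewrite -![_ *: (i == j)%:R]/(_ * (i == j)%:R); ring.
apply: (is_derive_eq (is_derive_chain qD (is_derive1_sqrt q0))).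
rewrite (bigD1 i) //= eqxx big1 ?addr0 => [|j]; last first.
  by rewrite eq_sym => /negPf ->; rewrite mulr0.
rewrite -[Num.sqrt _]/(radius x) -[_ *: _]/(_ * _) mulr1.
by field; rewrite gt_eqF.
Qed.

Lemma is_derive_vecpart x i : is_derive x (e_ i) (@vecpart R n) (clgen R i).
Proof.
have -> : clgen R i = \sum_(j < n) (i == j)%:R *: clgen R j.
  rewrite (bigD1 i) //= eqxx scale1r big1 ?addr0 // => j.
  by rewrite eq_sym => /negPf ->; rewrite scale0r.
apply: is_derive_bigsum => j.
apply: (is_derive_eq (is_derive_scale (is_derive_coord x (e_ i) (lift ord0 j))
  (is_derive_cst (clgen R j) x (e_ i)))).
by rewrite scaler0 addr0 mxE eqxx (inj_eq lift_inj) eq_sym.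
Qed.

Lemma line_x0 x h : [/\ (h *: e0 + x) ord0 ord0 = h + x ord0 ord0,
  radius (h *: e0 + x) = radius x & vecpart (h *: e0 + x) = vecpart x].
Proof.
have E i : (h *: e0 + x) ord0 (lift ord0 i) = x ord0 (lift ord0 i).
  by rewrite !mxE -val_eqE /= mulr0 add0r.
split; first by rewrite !mxE !eqxx mulr1.
- by rewrite /radius; under eq_bigr do rewrite E.
- by rewrite /vecpart; under eq_bigr do rewrite E.
Qed.

Lemma line_vec x i h : (h *: e_ i + x) ord0 ord0 = x ord0 ord0.
Proof. by rewrite !mxE -val_eqE /= mulr0 add0r. Qed.

Lemma radius_continuous : continuous (@radius R n).
Proof.
move=> x; apply: (@continuous_comp _ _ _ (fun y : 'rV[R]_n.+1 =>
  \sum_(i < n) y ord0 (lift ord0 i) ^+ 2) Num.sqrt); last exact: sqrt_continuous.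
have := @continuous_big R 'I_n +%R 0 xpredT add_continuous 'rV[R]_n.+1 (index_enum 'I_n)
  (fun i y => y ord0 (lift ord0 i) ^+ 2); apply => i _ y.
apply: (@continuous_comp _ _ _ (fun y : 'rV[R]_n.+1 => y ord0 (lift ord0 i))
  (fun t => t ^+ 2)); [exact: coord_continuous|exact: exprn_continuous].
Qed.

Lemma open_axial_domain (D : set R[i]^o) : open D -> open (axial_domain (n := n) D).
Proof.
move=> Do; apply: open_comp Do => x _.
apply: complex_continuous; first exact: coord_continuous.
exact: radius_continuous.
Qed.

Definition slice_point j u v : 'rV[R]_n.+1 := u *: e0 + v *: e_ j.

Lemma slice_point_x0 j u v : slice_point j u v ord0 ord0 = u.
Proof. by rewrite !mxE -!val_eqE /= !(mulr0, mulr1) addr0. Qed.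

Lemma slice_point_vec j i u v :
  slice_point j u v ord0 (lift ord0 i) = (i == j)%:R * v.
Proof. by rewrite !mxE (inj_eq lift_inj) /= mulr0 add0r mulrC. Qed.

Lemma radius_slice_point j u v : radius (slice_point j u v) = `|v|.
Proof.
rewrite /radius (bigD1 j) //= big1 => [|i /negPf ij].
  by rewrite slice_point_vec eqxx mul1r addr0 sqrtr_sqr.
by rewrite slice_point_vec ij mul0r expr0n.
Qed.

Lemma vecpart_slice_point j u v : vecpart (slice_point j u v) = v *: clgen R j.
Proof.
rewrite /vecpart (bigD1 j) //= big1 => [|i /negPf ij].
  by rewrite slice_point_vec eqxx mul1r addr0.
by rewrite slice_point_vec ij mul0r scale0r.
Qed.

End ParavectorGeometry.

(** * Differential operators on axial functions *)

Section AxialFunctions.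
Variables (R : realType) (n : nat) (D : set R[i]^o).
Hypotheses (Do : open D) (Dpos : forall z, D z -> 0 < complex.Im z).
Local Notation Cl := (clifford R n).
Local Notation Omega := (axial_domain (n := n) D).
Implicit Types (P H F G : R -> R -> Cl) (x : 'rV[R]_n.+1).
Implicit Types (f g : 'rV[R]_n.+1 -> Cl) (i j : 'I_n).
Local Notation e0 := (delta_mx ord0 ord0 : 'rV[R]_n.+1).
Local Notation e_ i := (delta_mx ord0 (lift ord0 i) : 'rV[R]_n.+1).

(** The vector profile multiplies the vector part itself and not its direction
    omega: the vector part is linear in x, which keeps derivatives simple. *)
Definition axial P H x : Cl :=
  P (x ord0 ord0) (radius x) + vecpart x * H (x ord0 ord0) (radius x).

Lemma eq_axial P P' H H' x : Omega x ->
  eq_on D P P' -> eq_on D H H' -> axial P H x = axial P' H' x.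
Proof. by move=> Ox PP' HH'; rewrite /axial PP' // HH'. Qed.

Lemma radius_gt0 x : Omega x -> 0 < radius x.
Proof. by move/Dpos. Qed.

Lemma partial_val f g x k dg : Omega x -> (forall y, Omega y -> f y = g y) ->
  is_derive x (delta_mx ord0 k) g dg -> partial k f x = dg.
Proof.
move=> Ox fg dgP; rewrite /partial.
have /near_eq_derive -> : \forall y \near x, f y = g y.
  by apply: filterS fg _; apply: open_nbhs_nbhs; split => //; apply: open_axial_domain.
by case: dgP.
Qed.

Lemma is_derive_profile_x0 P x : derivable_on D P -> Omega x ->
  is_derive x e0 (fun y => P (y ord0 ord0) (radius y))
    (d_x0 P (x ord0 ord0) (radius x)).
Proof.
move=> dP Ox; apply/is_derive_line0P.
rewrite (_ : (fun h => _) = fun h : R => P (h *: 1 + x ord0 ord0) (radius x)).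
  exact: (is_derive_line0P (P^~ (radius x)) _ _ _).1 (dP.1 _ _ Ox).
by apply/funext => h; have [-> -> _] := line_x0 x h; rewrite [_ *: 1]mulr1.
Qed.

Lemma is_derive_profile_vec P x i : derivable_on D P -> Omega x ->
  is_derive x (e_ i) (fun y => P (y ord0 ord0) (radius y))
    ((x ord0 (lift ord0 i) / radius x) *: d_r P (x ord0 ord0) (radius x)).
Proof.
move=> dP Ox; have := is_derive_chain (is_derive_radius i (radius_gt0 Ox)) (dP.2 _ _ Ox).
move=> /is_derive_line0P PD; apply/is_derive_line0P.
by under eq_fun do rewrite line_vec.
Qed.

Lemma is_derive_axial_x0 P H x : derivable_on D P -> derivable_on D H ->
  Omega x -> is_derive x e0 (axial P H) (axial (d_x0 P) (d_x0 H) x).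
Proof.
move=> dP dH Ox; apply: is_deriveD; first exact: is_derive_profile_x0.
have vD : is_derive x e0 (@vecpart R n) 0.
  apply/is_derive_line0P.
  rewrite (_ : (fun h => _) = cst (vecpart x)); first exact: is_derive_cst.
  by apply/funext => h; have [_ _ ->] := line_x0 x h.
apply: (is_derive_eq (is_derive_clmul vD (is_derive_profile_x0 dH Ox))).
by rewrite mul0r add0r.
Qed.

(** Up to the factor x_i and the term e_i H the derivative is axial again, so
    this lemma can be applied to its own result for second derivatives. *)
Lemma is_derive_axial_vec P H x i : derivable_on D P -> derivable_on D H ->
  Omega x -> is_derive x (e_ i) (axial P H)
   (x ord0 (lift ord0 i) *: axial (weight 1 1 (d_r P)) (weight 1 1 (d_r H)) x
     + clgen R i * H (x ord0 ord0) (radius x)).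
Proof.
move=> dP dH Ox.
apply: (is_derive_eq (is_deriveD (is_derive_profile_vec i dP Ox)
  (is_derive_clmul (is_derive_vecpart x i) (is_derive_profile_vec i dH Ox)))).
rewrite /axial /weight expr1 div1r -!scalerAr scalerDr !scalerA.
by rewrite [in RHS]addrAC -[RHS]addrA.
Qed.

Lemma sum_vecpart x (c : Cl) :
  \sum_(i < n) x ord0 (lift ord0 i) *: (clgen R i * c) = vecpart x * c.
Proof. by rewrite mulr_suml; apply: eq_bigr => i _; rewrite scalerAl. Qed.

Lemma sum_radial x (a b c : Cl) :
  \sum_(i < n) (a + x ord0 (lift ord0 i) ^+ 2 *: b
               + 2 *: (x ord0 (lift ord0 i) *: (clgen R i * c))) =
  n%:R *: a + radius x ^+ 2 *: b + 2 *: (vecpart x * c).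
Proof.
rewrite !big_split /= -scaler_sumr sum_vecpart sumr_const card_ord.
by rewrite -scaler_suml -radius_sqr scaler_nat.
Qed.

(** The term n H comes from the n squares e_i e_i = - 1, and r H_r from
    x' x' = - r^2. *)
Lemma conj_dirac_axial P H f x : derivable_on D P -> derivable_on D H ->
  (forall y, Omega y -> f y = axial P H y) -> Omega x ->
  conj_dirac f x =
  axial (fun u v => d_x0 P u v + (n%:R *: H u v + v *: d_r H u v))
        (fun u v => d_x0 H u v - v^-1 *: d_r P u v) x.
Proof.
move=> dP dH fE Ox; rewrite /conj_dirac.
rewrite (partial_val Ox fE (is_derive_axial_x0 dP dH Ox)).
under eq_bigr do rewrite (partial_val Ox fE (is_derive_axial_vec _ dP dH Ox))
  mulrDr mulrA clgen_sqr mulN1r -scalerAr.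
rewrite big_split /= sum_vecpart sumr_const card_ord /axial /weight.
have r0 : radius x != 0 by rewrite gt_eqF // radius_gt0.
have := vecpart_sqr x; move: r0; set r := radius x; set u := x ord0 ord0.
generalize r (vecpart x) (P u r) (d_x0 P u r) (d_r P u r)
  (H u r) (d_x0 H u r) (d_r H u r).
move=> {}r w P0 Px Pr H0 Hx Hr r0 wE.
have {wE} wE : w * w * Hr = - (r ^+ 2) *: Hr by rewrite wE -scalerAl mul1r.
rewrite expr1 div1r mulrDr mulrA -!scalerAr mulrBr -scalerAr wE -scaler_nat.
by apply/rowP => k; rewrite !mxE; field.
Qed.

(** With P' = P_r / r the sum of the second derivatives is n P' + r P'_r, that is
    P_rr + (n - 1) / r P_r; for H the two cross terms e_i H' x_i add 2 x' H',
    so that n + 2 replaces n. *)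
Lemma laplacian_axial P H f x : smooth_on D 2 P -> smooth_on D 2 H ->
  (forall y, Omega y -> f y = axial P H y) -> Omega x ->
  laplacian f x =
  axial (fun u v => d_x0 (d_x0 P) u v + d_r (d_r P) u v
           + ((n%:R - 1) / v) *: d_r P u v)
        (fun u v => d_x0 (d_x0 H) u v + d_r (d_r H) u v
           + ((n%:R + 1) / v) *: d_r H u v) x.
Proof.
move=> sP sH fE Ox.
have [dP dH] := (smooth_derivable sP isT, smooth_derivable sH isT).
have [dPx dHx] := (smooth_derivable (smooth_d_x0 sP) isT,
  smooth_derivable (smooth_d_x0 sH) isT).
have [dPr dHr] := (smooth_derivable (smooth_d_r sP) isT,
  smooth_derivable (smooth_d_r sH) isT).
have ddiv F : smooth_on D 1 F -> derivable_on D (weight 1 1 F).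
  by move=> sF; apply: (smooth_derivable (smooth_weight Do Dpos 1 1 sF) isT).
have [dP1 dH1] := (ddiv _ (smooth_d_r sP), ddiv _ (smooth_d_r sH)).
have p0E y : Omega y -> partial ord0 f y = axial (d_x0 P) (d_x0 H) y.
  by move=> Oy; exact: (partial_val Oy fE (is_derive_axial_x0 dP dH Oy)).
have piE i y : Omega y -> partial (lift ord0 i) f y =
   y ord0 (lift ord0 i) *: axial (weight 1 1 (d_r P)) (weight 1 1 (d_r H)) y
     + clgen R i * H (y ord0 ord0) (radius y).
  by move=> Oy; exact: (partial_val Oy fE (is_derive_axial_vec _ dP dH Oy)).
rewrite /laplacian big_ord_recl (partial_val Ox p0E (is_derive_axial_x0 dPx dHx Ox)).
set r := radius x; set u := x ord0 ord0.
have r0 : r != 0 by rewrite gt_eqF // radius_gt0.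
have regroup (a b c : Cl) : a + (b + c) + c = a + b + 2 *: c.
  by rewrite scaler_nat mulr2n !addrA.
have piiE i : partial (lift ord0 i) (partial (lift ord0 i) f) x =
    axial (weight 1 1 (d_r P)) (weight 1 1 (d_r H)) x
    + x ord0 (lift ord0 i) ^+ 2 *: axial (weight 1 1 (d_r (weight 1 1 (d_r P))))
                           (weight 1 1 (d_r (weight 1 1 (d_r H)))) x
    + 2 *: (x ord0 (lift ord0 i) *: (clgen R i * weight 1 1 (d_r H) u r)).
  have D1 := is_derive_scale (is_derive_coord x (e_ i) (lift ord0 i))
    (is_derive_axial_vec i dP1 dH1 Ox).
  have D2 := is_derive_clmul (is_derive_cst (clgen R i) x (e_ i))
    (is_derive_profile_vec i dH Ox).
  rewrite (partial_val Ox (piE i) (is_deriveD D1 D2)) mul0r add0r.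
  have -> : cst (clgen R i) x * ((x ord0 (lift ord0 i) / r) *: d_r H u r) =
      x ord0 (lift ord0 i) *: (clgen R i * weight 1 1 (d_r H) u r).
    by rewrite /weight expr1 div1r -!scalerAr scalerA.
  rewrite mxE !eqxx scale1r -/r -/u.
  rewrite (scalerDr (x ord0 (lift ord0 i)) (_ *: _)) scalerA -expr2.
  exact: regroup.
under eq_bigr do rewrite piiE.
rewrite sum_radial /axial -/r -/u.
have dd F : derivable_on D F -> weight 1 1 (d_r (weight 1 1 F)) u r =
    r^-1 *: (r^-1 *: d_r F u r - r^-2 *: F u r).
  move=> dF; rewrite {1}/weight (is_d_r_eq (is_d_r_weight Dpos 1 1 dF.2) Ox).
  rewrite /plus /weight -/r -/u.
  by apply/rowP => k; rewrite !mxE; field; exact: r0.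
(* From here on the derivatives are mere vectors, and the identity is one of
   linear combinations over R. *)
move: (dd _ dPr) (dd _ dHr).
generalize (weight 1 1 (d_r (weight 1 1 (d_r P))) u r)
  (weight 1 1 (d_r (weight 1 1 (d_r H))) u r).
rewrite /weight expr1 div1r.
generalize (d_x0 (d_x0 P) u r) (d_r (d_r P) u r) (d_r P u r).
generalize (d_x0 (d_x0 H) u r) (d_r (d_r H) u r) (d_r H u r).
move=> H00 Hrr Hr P00 Prr Pr Prr' Hrr' -> ->.
have sA (a : R) (b c : Cl) : b * (a *: c) = a *: (b * c) by rewrite scalerAr.
rewrite !(mulrDr, mulrN, sA); apply/rowP => k; rewrite !mxE.
field; exact: r0.
Qed.

(** At the points u + v e_j and u - v e_j the vector parts are opposite, so both
    P and e_j H vanish, and e_j is invertible. *)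
Lemma axial_eq0 P H u v j : D (u +i* v)%C ->
  (forall x, Omega x -> axial P H x = 0) -> P u v = 0 /\ H u v = 0.
Proof.
move=> Duv ax0; have v0 := Dpos Duv; rewrite /= in v0.
have axE s : `|s| = v -> P u v + s *: (clgen R j * H u v) = 0.
  move=> sv; have := ax0 (slice_point j u s).
  rewrite /axial_domain /axial /= slice_point_x0 radius_slice_point sv.
  by rewrite vecpart_slice_point scalerAl; apply.
have E1 := axE v (gtr0_norm v0).
have E2 : P u v + (- v) *: (clgen R j * H u v) = 0.
  by apply: axE; rewrite normrN gtr0_norm.
have P0 : P u v = 0.
  apply/rowP => k; move/rowP: E1 => /(_ k); move/rowP: E2 => /(_ k).
  rewrite !mxE; lra.
split=> //; have {E1}/eqP := E1; rewrite P0 add0r scaler_eq0 gt_eqF //= => /eqP E1.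
have /(congr1 (fun z => clgen R j * z)) := E1.
by rewrite mulrA clgen_sqr mulN1r mulr0 => /eqP; rewrite oppr_eq0 => /eqP.
Qed.

Section Slices.
Variable j : 'I_n.

(** The combinations of f at two opposite points which recover its profiles:
    s = 1 picks the even profile and s = - 1 the odd one. *)
Definition slice (c : Cl) (s : R) f u v : Cl :=
  c * (f (slice_point j u v) + s *: f (slice_point j u (- v))).

Lemma slice_point_domain u v : D (u +i* v)%C ->
  Omega (slice_point j u v) /\ Omega (slice_point j u (- v)).
Proof.
move=> Duv; have v0 := Dpos Duv; rewrite /= in v0.
by rewrite /axial_domain /= !slice_point_x0 !radius_slice_point normrN gtr0_norm.
Qed.

Lemma is_d_x0_slice k c s f : class_C k.+1 Omega f ->
  is_d_x0 D (slice c s f) (slice c s (partial ord0 f)).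
Proof.
move=> fC u v Duv; have [dom1 dom2] := slice_point_domain Duv.
have der w : Omega (slice_point j u w) ->
    is_derive u 1 (fun t => f (slice_point j t w)) (partial ord0 f (slice_point j u w)).
  move=> Ow; apply/(is_derive_lineP f).
  by apply: derivableP; apply: (class_C_derivable fC).
apply: (is_derive_eq (is_derive_clmul (is_derive_cst c u 1)
  (is_deriveD (der v dom1) (is_deriveZ s (der (- v) dom2))))).
by rewrite mul0r add0r.
Qed.

(** The chain rule for v |-> - v turns s into - s. *)
Lemma is_d_r_slice k c s f : class_C k.+1 Omega f ->
  is_d_r D (slice c s f) (slice c (- s) (partial (lift ord0 j) f)).
Proof.
move=> fC u v Duv; have [dom1 dom2] := slice_point_domain Duv.
have der w : Omega (slice_point j u w) ->
    is_derive w 1 (fun t => f (slice_point j u t))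
      (partial (lift ord0 j) f (slice_point j u w)).
  have E t : slice_point j u t = t *: e_ j + u *: e0 by rewrite /slice_point addrC.
  move=> Ow; rewrite (_ : (fun t => _) = fun t => f (t *: e_ j + u *: e0)).
    rewrite E; apply/(is_derive_lineP f); rewrite -E.
    by apply: derivableP; apply: (class_C_derivable fC).
  by apply/funext => t; rewrite E.
apply: (is_derive_eq (is_derive_clmul (is_derive_cst c v 1)
    (is_deriveD (der v dom1)
       (is_deriveZ s (is_derive_chain (is_deriveNid v 1) (der (- v) dom2)))))).
by rewrite mul0r add0r /slice scaleN1r scalerN scaleNr.
Qed.

(** Slices of f are differentiated by differentiating f, hence Schwarz's theorem
    for f gives the exchange of derivatives. *)
Lemma smooth_slice k c s f : class_C k Omega f -> smooth_on D k (slice c s f).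
Proof.
elim: k c s f => [|k IHk] c s f fC; first by [].
have xE l c' s' (g : 'rV[R]_n.+1 -> Cl) (gC : class_C l.+1 Omega g) u v Duv :=
  esym (is_d_x0_eq (is_d_x0_slice c' s' gC) Duv : _ u v = _ u v).
have rE l c' s' (g : 'rV[R]_n.+1 -> Cl) (gC : class_C l.+1 Omega g) u v Duv :=
  esym (is_d_r_eq (is_d_r_slice c' s' gC) Duv : _ u v = _ u v).
split.
- exact: derivable_onI (is_d_x0_slice c s fC) (is_d_r_slice c s fC).
- case: k {IHk} fC => [|k] fC k0 u v Duv; first by case: (notF k0).
  have [dom1 dom2] := slice_point_domain Duv.
  rewrite -[LHS](eq_d_x0 Do (rE _ _ _ _ fC) Duv) -[RHS](eq_d_r Do (xE _ _ _ _ fC) Duv).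
  rewrite -[LHS](xE _ _ _ _ (class_C_partial _ fC) _ _ Duv).
  rewrite -[RHS](rE _ _ _ _ (class_C_partial _ fC) _ _ Duv) /slice.
  have PC := fun y =>
    @partialC R n Omega k f ord0 (lift ord0 j) y (open_axial_domain Do) fC.
  by rewrite (PC _ dom1) (PC _ dom2).
- exact: eq_smooth (xE _ _ _ _ fC) (IHk _ _ _ (class_C_partial _ fC)).
- exact: eq_smooth (rE _ _ _ _ fC) (IHk _ _ _ (class_C_partial _ fC)).
Qed.

(** Since omega is e_j and - e_j at the two points, the half sum of the values
    of f is A and the half difference is e_j B. *)
Lemma axial_decomposition_slices f A B : axial_decomposition D f A B ->
  eq_on D (slice (2^-1 *: 1) 1 f) A /\ eq_on D (slice (- 2^-1 *: clgen R j) (- 1) f) B.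
Proof.
move=> fE.
have fs u s v : D (u +i* v)%C -> `|s| = v ->
    f (slice_point j u s) = A u v + (v^-1 * s) *: (clgen R j * B u v).
  move=> Duv sv; rewrite fE /axial_domain /omega /=;
    rewrite ?slice_point_x0 ?radius_slice_point ?sv //.
  by rewrite vecpart_slice_point scalerA scalerAl.
have pos u v : D (u +i* v)%C -> `|v| = v /\ `|- v| = v.
  by move=> /Dpos /= v0; rewrite normrN gtr0_norm.
split=> u v Duv; have [v1 v2] := pos u v Duv; rewrite /slice.
  rewrite (fs u v v Duv v1) (fs u (- v) v Duv v2) mulrN scaleNr scale1r.
  rewrite addrACA subrr addr0 -scalerAl mul1r -mulr2n -[A u v *+ 2]scaler_nat scalerA.
  by rewrite mulVf ?scale1r ?pnatr_eq0.
rewrite (fs u v v Duv v1) (fs u (- v) v Duv v2) mulrN !scaleNr !scale1r.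
rewrite (mulVf (halfplane_neq0 Dpos Duv)) scale1r.
set b := clgen R j * B u v.
have -> : A u v + b - (A u v - b) = 2 *: b by apply/rowP => k; rewrite !mxE; ring.
rewrite mulNr -scalerAl -scalerAr scalerA mulVf ?pnatr_eq0 // scale1r.
by rewrite mulrA clgen_sqr mulN1r opprK.
Qed.

End Slices.

End AxialFunctions.

(** * The system in dimension six *)

Section DimensionSix.
Variables (R : realType) (D : set R[i]^o).
Hypotheses (Do : open D) (Dpos : forall z, D z -> 0 < complex.Im z).
Local Notation Cl := (clifford R 5).
Implicit Types (A B : R -> R -> Cl) (u v : R).

(** With dirac_vector, the profiles of conj_dirac f in the sense of axial when f
    has the axial decomposition A, B. *)
Definition dirac_scalar A B : R -> R -> Cl :=
  plus (d_x0 A) (plus (d_r B) (weight 4 1 B)).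

(** The difference (B_0 - A_r) / r, with the sign written as the weight - 1 / r^0
    so that the closure lemmas for sums and weights apply to it. *)
Definition dirac_vector A B : R -> R -> Cl :=
  weight 1 1 (plus (d_x0 B) (weight (- 1) 0 (d_r A))).

Lemma smooth_dirac_scalar k A B : smooth_on D k.+1 A -> smooth_on D k.+1 B ->
  smooth_on D k (dirac_scalar A B).
Proof.
move=> sA sB.
apply: (smooth_plus Do (smooth_d_x0 sA)); apply: (smooth_plus Do (smooth_d_r sB)).
exact: (smooth_weight Do Dpos 4 1 (smooth_le (leqnSn k) sB)).
Qed.

Lemma smooth_dirac_vector k A B : smooth_on D k.+1 A -> smooth_on D k.+1 B ->
  smooth_on D k (dirac_vector A B).
Proof.
move=> sA sB.
apply: (smooth_weight Do Dpos 1 1); apply: (smooth_plus Do (smooth_d_x0 sB)).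
exact: (smooth_weight Do Dpos (- 1) 0 (smooth_d_r sA)).
Qed.

Lemma conj_dirac_decomposition A B f x : smooth_on D 1 A -> smooth_on D 1 B ->
  axial_decomposition D f A B -> axial_domain D x ->
  conj_dirac f x = axial (dirac_scalar A B) (dirac_vector A B) x.
Proof.
move=> sA sB fE Ox.
have dA := smooth_derivable sA isT; have dB := smooth_derivable sB isT.
have dH : derivable_on D (weight 1 1 B).
  exact: smooth_derivable (smooth_weight Do Dpos 1 1 sB) isT.
have fax y : axial_domain D y -> f y = axial A (weight 1 1 B) y.
  move=> Oy; rewrite fE // /axial /omega /weight expr1 div1r.
  by rewrite -scalerAl -scalerAr.
rewrite (conj_dirac_axial Do Dpos dA dH fax Ox); apply: (eq_axial Ox) => u v Duv.
  rewrite (is_d_r_eq (is_d_r_weight Dpos 1 1 dB.2) Duv).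
  rewrite /dirac_scalar /plus /weight.
  have v0 := halfplane_neq0 Dpos Duv.
  generalize (d_x0 A u v) (d_r B u v) (B u v) => a b c.
  by apply/rowP => k; rewrite !mxE; field.
rewrite (is_d_x0_eq (is_d_x0_weight 1 1 dB.1) Duv) /dirac_vector /plus /weight.
have v0 := halfplane_neq0 Dpos Duv.
generalize (d_x0 B u v) (d_r A u v) => a b.
by apply/rowP => k; rewrite !mxE; field.
Qed.

(** Expansion of the derivatives of A_0 + B_r + 4 B / r, after which the mixed
    derivatives of third order are brought to the order of the system. *)
Lemma laplacian_dirac_scalar A B u v :
  smooth_on D 3 A -> smooth_on D 3 B -> D (u +i* v)%C ->
  let P := dirac_scalar A B in
  d_x0 (d_x0 P) u v + d_r (d_r P) u v + ((5%:R - 1) / v) *: d_r P u v =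
    d_x0 (d_x0 (d_x0 A)) u v
    + d_x0 (d_r (d_r A)) u v
    + (4 / v) *: d_x0 (d_r A) u v
    + d_r (d_x0 (d_x0 B)) u v
    + d_r (d_r (d_r B)) u v
    + (8 / v) *: d_r (d_r B) u v
    + (8 / v ^+ 2) *: d_r B u v
    - (8 / v ^+ 3) *: B u v
    + (4 / v) *: d_x0 (d_x0 B) u v.
Proof.
move=> sA sB Duv P.
have [[Bx Br] sAx sAr] := And3 (smooth_derivable sB isT) (smooth_d_x0 sA) (smooth_d_r sA).
have [sBx sBr] := (smooth_d_x0 sB, smooth_d_r sB).
have [[Axx Axr] [Bxx _] [Brx Brr]] := And3 (smooth_derivable sAx isT)
  (smooth_derivable sBx isT) (smooth_derivable sBr isT).
have [_ Axrr] := smooth_derivable (smooth_d_r sAx) isT.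
have [Axxx _] := smooth_derivable (smooth_d_x0 sAx) isT.
have [_ Brrr] := smooth_derivable (smooth_d_r sBr) isT.
have [Brxx _] := smooth_derivable (smooth_d_x0 sBr) isT.
have Px := is_d_x0_eq (is_d_x0_plus Axx (is_d_x0_plus Brx (is_d_x0_weight 4 1 Bx))).
have Pxx := etrans (eq_d_x0 Do Px Duv) (is_d_x0_eq
  (is_d_x0_plus Axxx (is_d_x0_plus Brxx (is_d_x0_weight 4 1 Bxx))) Duv).
have Pr := is_d_r_eq
  (is_d_r_plus Axr (is_d_r_plus Brr (is_d_r_weight Dpos 4 1 Br))).
have Prr := etrans (eq_d_r Do Pr Duv) (is_d_r_eq
  (is_d_r_plus Axrr (is_d_r_plus Brrr (is_d_r_plus
    (is_d_r_weight Dpos (- 4 * 1%:R) 2 Br) (is_d_r_weight Dpos 4 1 Brr)))) Duv).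
have v0 := halfplane_neq0 Dpos Duv.
move: Pxx Prr (Pr u v Duv) (smoothC sA Duv).
move: (etrans (smoothC sAr Duv) (eq_d_r Do (smoothC sA) Duv)).
move: (etrans (eq_d_x0 Do (smoothC sB) Duv) (smoothC sBx Duv)).
rewrite -/(dirac_scalar A B) -/P /plus /weight.
generalize (d_x0 (d_x0 P) u v) (d_r (d_r P) u v) (d_r P u v).
generalize (d_x0 (d_x0 (d_r B)) u v) (d_r (d_r (d_x0 A)) u v) (d_r (d_x0 A) u v).
generalize (d_x0 (d_x0 (d_x0 A)) u v) (d_x0 (d_r (d_r A)) u v) (d_x0 (d_r A) u v)
  (d_r (d_x0 (d_x0 B)) u v) (d_r (d_r (d_r B)) u v) (d_r (d_r B) u v)
  (d_r B u v) (B u v) (d_x0 (d_x0 B) u v).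
move=> A000 A0rr A0r Br00 Brrr' Brr' Br' B0 B00 B00r Arr0 Ar0 P00 Prr Pr'.
move=> -> <- -> -> -> ->.
by apply/rowP => l; rewrite !mxE; field.
Qed.

(** Expansion of the derivatives of (B_0 - A_r) / r; the factor v clears the
    division by r. *)
Lemma laplacian_dirac_vector A B u v :
  smooth_on D 3 A -> smooth_on D 3 B -> D (u +i* v)%C ->
  let Q := dirac_vector A B in
  v *: (d_x0 (d_x0 Q) u v + d_r (d_r Q) u v + ((5%:R + 1) / v) *: d_r Q u v) =
    d_x0 (d_x0 (d_x0 B)) u v
    + d_x0 (d_r (d_r B)) u v
    + 4 *: d_r (fun u v => v^-1 *: d_x0 B u v) u v
    - d_r (d_x0 (d_x0 A)) u v
    - d_r (d_r (d_r A)) u v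
    - 4 *: d_r (fun u v => v^-1 *: d_r A u v) u v.
Proof.
move=> sA sB Duv Q.
have divE (F : R -> R -> Cl) : (fun u v => v^-1 *: F u v) = weight 1 1 F.
  by apply/funext => a; apply/funext => b; rewrite /weight expr1 div1r.
have [[sAx sAr] [sBx sBr]] := ((smooth_d_x0 sA, smooth_d_r sA),
  (smooth_d_x0 sB, smooth_d_r sB)).
have [[Arx Arr] [Bxx Bxr]] := (smooth_derivable sAr isT, smooth_derivable sBx isT).
have [Arxx _] := smooth_derivable (smooth_d_x0 sAr) isT.
have [_ Arrr] := smooth_derivable (smooth_d_r sAr) isT.
have [Bxxx _] := smooth_derivable (smooth_d_x0 sBx) isT.
have [_ Bxrr] := smooth_derivable (smooth_d_r sBx) isT.
pose q := plus (d_x0 B) (weight (- 1) 0 (d_r A)).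
have sq : smooth_on D 2 q := smooth_plus Do sBx (smooth_weight Do Dpos (- 1) 0 sAr).
have [qx qr] := smooth_derivable sq isT.
have [qxx _] := smooth_derivable (smooth_d_x0 sq) isT.
have [_ qrr] := smooth_derivable (smooth_d_r sq) isT.
have qxE := is_d_x0_eq (is_d_x0_plus Bxx (is_d_x0_weight (- 1) 0 Arx)).
have qxxE := etrans (eq_d_x0 Do qxE Duv)
  (is_d_x0_eq (is_d_x0_plus Bxxx (is_d_x0_weight (- 1) 0 Arxx)) Duv).
have qrE := is_d_r_eq (is_d_r_plus Bxr (is_d_r_weight Dpos (- 1) 0 Arr)).
have qrrE := etrans (eq_d_r Do qrE Duv) (is_d_r_eq
  (is_d_r_plus Bxrr (is_d_r_plus (is_d_r_weight Dpos (- (- 1) * 0%:R) 1 Arr)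
     (is_d_r_weight Dpos (- 1) 0 Arrr))) Duv).
have QxE := is_d_x0_eq (is_d_x0_weight 1 1 qx).
have QxxE := etrans (eq_d_x0 Do QxE Duv) (is_d_x0_eq (is_d_x0_weight 1 1 qxx) Duv).
have QrE := is_d_r_eq (is_d_r_weight Dpos 1 1 qr).
have QrrE := etrans (eq_d_r Do QrE Duv) (is_d_r_eq
  (is_d_r_plus (is_d_r_weight Dpos (- 1 * 1%:R) 2 qr) (is_d_r_weight Dpos 1 1 qrr)) Duv).
have v0 := halfplane_neq0 Dpos Duv.
have q0E : q u v = d_x0 B u v + (- 1 / v ^+ 0) *: d_r A u v := erefl.
rewrite !divE; move: QxxE QrrE (QrE u v Duv) qxxE qrrE (qrE u v Duv) q0E.
move: (etrans (smoothC sBr Duv) (eq_d_r Do (smoothC sB) Duv)).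
move: (etrans (eq_d_x0 Do (smoothC sA) Duv) (smoothC sAx Duv)).
move: (is_d_r_eq (is_d_r_weight Dpos 1 1 Bxr) Duv).
move: (is_d_r_eq (is_d_r_weight Dpos 1 1 Arr) Duv).
rewrite -/q -/(dirac_vector A B) -/Q.
generalize (d_r (weight 1 1 (d_r A)) u v) (d_r (weight 1 1 (d_x0 B)) u v).
generalize (d_x0 (d_x0 Q) u v) (d_r (d_r Q) u v) (d_r Q u v).
rewrite /plus /weight.
generalize (d_x0 (d_x0 q) u v) (d_r (d_r q) u v) (d_r q u v) (q u v).
generalize (d_x0 (d_x0 (d_r A)) u v) (d_r (d_r (d_x0 B)) u v).
generalize (d_x0 (d_x0 (d_x0 B)) u v) (d_r (d_x0 (d_x0 A)) u v)
  (d_x0 (d_r (d_r B)) u v) (d_r (d_r (d_r A)) u v) (d_r (d_r A) u v)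
  (d_r (d_x0 B) u v) (d_r A u v) (d_x0 B u v).
move=> B000 Ar00 B0rr Arrr' Arr' Br0 Ar B0 A00r Brr0 q00 qrr' qr' q0 Q00 Qrr Qr dA dB.
move=> -> -> -> <- -> -> -> -> -> -> ->.
by apply/rowP => l; rewrite !mxE; field.
Qed.

End DimensionSix.

Theorem theorem5p1 (R : realType) (D : set R[i]^o)
    (f : 'rV[R]_6 -> clifford R 5) (A B : R -> R -> clifford R 5) :
  upper_half_plane_domain D ->
  axially_antiCliffordian_order1 D f ->
  axial_decomposition D f A B ->
  forall x0 r : R, D (x0 +i* r)%C ->
    d_x0 (d_x0 (d_x0 A)) x0 r
    + d_x0 (d_r (d_r A)) x0 r
    + (4 / r) *: d_x0 (d_r A) x0 r
    + d_r (d_x0 (d_x0 B)) x0 r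
    + d_r (d_r (d_r B)) x0 r
    + (8 / r) *: d_r (d_r B) x0 r
    + (8 / r ^+ 2) *: d_r B x0 r
    - (8 / r ^+ 3) *: B x0 r
    + (4 / r) *: d_x0 (d_x0 B) x0 r = 0
    /\
    d_x0 (d_x0 (d_x0 B)) x0 r
    + d_x0 (d_r (d_r B)) x0 r
    + 4 *: d_r (fun u v => v^-1 *: d_x0 B u v) x0 r
    - d_r (d_x0 (d_x0 A)) x0 r
    - d_r (d_r (d_r A)) x0 r
    - 4 *: d_r (fun u v => v^-1 *: d_r A u v) x0 r = 0.
Proof.
move=> [Do _ _ Dpos] [_ fC fharm] fdec x0 r Dr.
have [EA EB] := axial_decomposition_slices Dpos ord0 fdec.
have sA : smooth_on D 3 A by apply: (eq_smooth Do EA); apply: smooth_slice.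
have sB : smooth_on D 3 B by apply: (eq_smooth Do EB); apply: smooth_slice.
have dE x : axial_domain D x ->
    conj_dirac f x = axial (dirac_scalar A B) (dirac_vector A B) x.
  exact: (conj_dirac_decomposition Do Dpos (smooth_le (isT : 1 <= 3)%N sA)
    (smooth_le (isT : 1 <= 3)%N sB) fdec).
have lapE x : axial_domain D x -> laplacian (conj_dirac f) x = _ :=
  fun Ox => laplacian_axial Do Dpos (smooth_dirac_scalar Do Dpos sA sB)
    (smooth_dirac_vector Do Dpos sA sB) dE Ox.
have [U0 W0] := axial_eq0 Dpos ord0 Dr
  (fun x Ox => etrans (esym (lapE x Ox)) (fharm x Ox)).
split.
  by rewrite -(laplacian_dirac_scalar Do Dpos sA sB Dr); exact: U0.
by rewrite -(laplacian_dirac_vector Do Dpos sA sB Dr) W0 scaler0.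
Qed.
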